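(* Let $p$ be a prime, $r\ge 1$ an integer and $q=p^r$. Let $X$ be a supersingular curve of genus $g$ defined over $\mathbb{F}_q$ with period $s$. Let $n$ be a positive integer, let $m=\gcd(n,s)$ and write $n=m\cdot t$. If $q$ is odd, then $$\#X(\mathbb{F}_{q^n})-(q^n+1)=\begin{cases} q^{(n-m)/2}\,[\#X(\mathbb{F}_{q^m})-(q^m+1)] & \text{if } m\cdot r \text{ is even},\\ q^{(n-m)/2}\,[\#X(\mathbb{F}_{q^m})-(q^m+1)]\left(\frac{(-1)^{(t-1)/2}t}{p}\right) & \text{if } m\cdot r \text{ is odd and } p\nmid t,\\ q^{(n-m)/2}\,[\#X(\mathbb{F}_{q^m})-(q^m+1)] & \text{if } m\cdot r \text{ is odd and } p\mid t.\end{cases}$$ If $q$ is even, then $$\#X(\mathbb{F}_{q^n})-(q^n+1)=\begin{cases} q^{(n-m)/2}\,[\#X(\mathbb{F}_{q^m})-(q^m+1)] & \text{if } m\cdot r \text{ is even},\\ q^{(n-m)/2}\,[\#X(\mathbb{F}_{q^m})-(q^m+1)]\,(-1)^{(t^2-1)/8} & \text{if } m\cdot r \text{ is odd}.\end{cases}$$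
   Context: A curve over $\mathbb{F}_q$ means a projective, smooth, absolutely irreducible curve defined over $\mathbb{F}_q$; $\#X(\mathbb{F}_{q^n})$ is its number of $\mathbb{F}_{q^n}$-rational points. The $L$-polynomial of $X$ over $\mathbb{F}_q$ is $L_X(T)=\exp\left(\sum_{n\ge1}(\#X(\mathbb{F}_{q^n})-q^n-1)\frac{T^n}{n}\right)$, a polynomial of degree $2g$ with integer coefficients and constant term $1$. The Weil numbers $\eta_1,\dots,\eta_{2g}\in\mathbb{C}$ of $X$ are the roots (with multiplicity) of the reciprocal polynomial of $L_X$, i.e. $L_X(T)=\prod_{i=1}^{2g}(1-\eta_iT)$; thus $\#X(\mathbb{F}_{q^n})-(q^n+1)=-\sum_{i=1}^{2g}\eta_i^n$ for all $n\ge1$. The curve $X$ is supersingular if every Weil number has the form $\eta_i=\sqrt q\,\zeta_i$ with $\zeta_i$ a root of unity. The period of a supersingular curve $X$ over $\mathbb{F}_q$ is the smallest positive integer $s$ such that $\zeta_i^s=1$ for all $i=1,\dots,2g$. The symbol $\left(\frac{\cdot}{p}\right)$ is the Legendre symbol. *)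

(* Defs.v *)
From mathcomp Require Import all_boot all_order all_algebra all_field.
From mathcomp Require Import reals complex.
From mathcomp Require Import mpoly.

Set Implicit Arguments.
Unset Strict Implicit.
Unset Printing Implicit Defensive.

Import Order.TTheory GRing.Theory Num.Theory.
Local Open Scope ring_scope.

Definition homog_system (K : fieldType) (N : nat) (S : seq {mpoly K[N.+1]}) :=
  all [pred f | f \is homog mdeg] S.

(* Points of P^N are represented by their nonzero vectors of homogeneous
   coordinates: [cone S] is the set of all representatives of the points of the
   closed subset of P^N defined by the system S. *)
Definition cone (K : fieldType) (N : nat) (S : seq {mpoly K[N.+1]})
  : pred 'rV[K]_N.+1 :=
  [pred v : 'rV[K]_N.+1 | (v != 0) && all [pred f | f.@[fun i => v 0 i] == 0] S].

Section ProjectiveTopology.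
Variables (K : closedFieldType) (N : nat).
Implicit Types S : seq {mpoly K[N.+1]}.

Definition closed_sub S1 S2 := {subset cone S1 <= cone S2}.

Definition irreducible_closed S :=
  (exists v, v \in cone S) /\
  forall S1 S2, homog_system S1 -> homog_system S2 ->
    (forall v, v \in cone S -> (v \in cone S1) || (v \in cone S2)) ->
    closed_sub S S1 \/ closed_sub S S2.

(* Z 0 < Z 1 < ... < Z k is a strict chain of irreducible closed subsets of S *)
Definition irreducible_chain S (k : nat) (Z : nat -> seq {mpoly K[N.+1]}) :=
  [/\ forall i, (i <= k)%N ->
        [/\ homog_system (Z i), irreducible_closed (Z i) & closed_sub (Z i) S]
    & forall i, (i < k)%N ->
        closed_sub (Z i) (Z i.+1) /\ ~ closed_sub (Z i.+1) (Z i)].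

Definition krull_dim S (d : nat) :=
  (exists Z, irreducible_chain S d Z) /\
  ~ (exists Z, irreducible_chain S d.+1 Z).

(* Jacobian criterion: the closed subscheme of P^N with equations S is smooth of
   dimension d at each of its points. *)
Definition jacobian (S : seq {mpoly K[N.+1]}) (v : 'rV[K]_N.+1)
  : 'M[K]_(size S, N.+1) :=
  \matrix_(j < size S, i < N.+1) ((nth 0 S j)^`M(i)).@[fun l => v 0 l].

Definition smooth_of_dim S (d : nat) :=
  forall v, v \in cone S -> (\rank (jacobian S v) + d = N)%N.

End ProjectiveTopology.

Section Curve.
Variable F : finFieldType.

Definition alg_closure : countClosedFieldType :=
  projT1 (countable_algebraic_closure F).

Definition to_closure : {rmorphism F -> alg_closure} :=
  sval (projT2 (countable_algebraic_closure F)).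

Definition base_change N (S : seq {mpoly F[N.+1]}) :=
  [seq map_mpoly to_closure f | f <- S].

(* The scheme Proj F[x_0..x_N]/(equations); projective smooth absolutely
   irreducible curves are these schemes up to isomorphism. *)
Record curve := Curve {
  ambient_dim : nat;
  equations : seq {mpoly F[ambient_dim.+1]};
  _ : homog_system equations;
  _ : irreducible_closed (base_change equations);
  _ : krull_dim (base_change equations) 1%N;
  _ : smooth_of_dim (base_change equations) 1%N
}.

Lemma frobenius_poly_neq0 (n : nat) :
  'X^(#|F| ^ n.+1) - 'X != 0 :> {poly F}.
Proof.
have F_gt1 : (1 < #|F| ^ n.+1)%N.
  by rewrite -(exp1n n.+1) ltn_exp2r ?finNzRing_gt1.
rewrite -size_poly_eq0 size_polyDl ?size_polyXn //.
by rewrite size_polyN size_polyX ltnS.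
Qed.

(* The extension of F of degree n, for n > 0: a splitting field of X^(q^n) - X *)
Definition ext_field (n : nat) :=
  finvect_type (sval (FinSplittingFieldFor (frobenius_poly_neq0 n.-1))).

Variable X : curve.

(* #X(F_{q^n}); a point is the line of its nonzero representatives *)
Definition nb_points (n : nat) : nat :=
  let S := [seq map_mpoly (in_alg (ext_field n)) f | f <- equations X] in
  #|[set [set c *: v | c : ext_field n & c != 0] | v in cone S]|.

Definition point_defect (n : nat) : int :=
  (nb_points n)%:Z - (#|F| ^ n + 1)%N%:Z.

(* These span the degree d part of the ideal; insub keeps the products that are
   homogeneous of degree d. *)
Definition ideal_generators (d : nat) : seq (dhomog (ambient_dim X).+1 F d) :=
  pmap insub [seq 'X_[bmnm m] * f
    | m <- enum {: 'X_{1..(ambient_dim X).+1 < d.+1}}, f <- equations X].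

Definition hilbert_function (d : nat) : nat :=
  (\dim {: dhomog (ambient_dim X).+1 F d} - \dim <<ideal_generators d>>%VS)%N.

(* Arithmetic genus, read off the Hilbert polynomial: for large d the degree d
   part of F[x_0..x_N]/(equations) has dimension deg(X) d + 1 - g. For a smooth
   curve this is the genus. *)
Definition genus (g : nat) :=
  exists e d0 : nat, forall d, (d0 <= d)%N ->
    (hilbert_function d + g = e * d + 1)%N.

End Curve.

(* Formal exponential of the series sum_k a_k T^k with a_0 = 0: since a^j starts
   in degree at least j, only a_0..a_k and the powers j <= k matter for the
   coefficient of T^k. *)
Definition fps_exp (a : nat -> rat) (k : nat) : rat :=
  (\sum_(j < k.+1) (j`!%:R)^-1 *: (\poly_(i < k.+1) a i) ^+ j)`_k.

(* L_X(T) = exp (sum_(n >= 1) (#X(F_{q^n}) - q^n - 1) T^n / n) *)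
Definition L_coef (F : finFieldType) (X : curve F) : nat -> rat :=
  fps_exp (fun n => if n == 0%N then 0 else (point_defect X n)%:~R / n%:R).

Definition weil_numbers (R : realType) (F : finFieldType) (X : curve F)
    (eta : seq R[i]) :=
  forall k, ratr (L_coef X k) = (\prod_(e <- eta) (1 - e *: 'X))`_k.

Definition root_of_unity (R : realType) (z : R[i]) :=
  exists2 k, (0 < k)%N & z ^+ k = 1.

(* In the next two definitions eta stands for the Weil numbers of a curve over
   the field with q elements. *)
Definition supersingular (R : realType) (q : nat) (eta : seq R[i]) :=
  forall e, e \in eta ->
    exists2 zeta, root_of_unity zeta & e = sqrtC (q%:R) * zeta.

Definition is_period (R : realType) (q : nat) (eta : seq R[i]) (s : nat) :=
  let kills k := forall e, e \in eta -> (e / sqrtC (q%:R)) ^+ k = 1 in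
  [/\ (0 < s)%N, kills s & forall k, (0 < k)%N -> kills k -> (s <= k)%N].

Definition legendre (a : int) (p : nat) : int :=
  if (p %| a)%Z then 0
  else if [exists x : 'I_p, ((x%:Z ^+ 2 == a %[mod p])%Z)] then 1 else -1.

(* Main.v *)
Require Import Defs.
From mathcomp Require Import all_boot all_order all_algebra all_field.
From mathcomp Require Import reals complex.
From mathcomp Require Import cyclic ring zify.

Set Implicit Arguments.
Unset Strict Implicit.
Unset Printing Implicit Defensive.

Import Order.TTheory GRing.Theory Num.Theory.
Local Open Scope ring_scope.

(* Write the Weil numbers as sqrt q * zeta_i, put y_i = zeta_i ^ m and N = s / m.
   The y_i are N-th roots of unity and t is prime to N, so the sum of the y_i ^ t
   is the image of the sum of the y_i under the automorphism w |-> w ^ t of the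
   N-th cyclotomic field. As the point counts are integers, the sum of the y_i is
   a rational multiple of sqrt p ^ (m r). If m r is even it is fixed by the
   automorphism. If m r is odd it is a rational multiple of sqrt p, and the
   action on sqrt p is read off a Gauss sum (from a primitive 8-th root of unity
   if p = 2). Both sums vanish if t is even, for then the second one is rational,
   and also if p is odd and divides t, for then p does not divide N and some
   automorphism fixes the N-th roots of unity but not sqrt p. *)

(** * Power sums of the Weil numbers from the L-polynomial, by congruences modulo powers of X *)

Lemma dvdXnP (K : fieldType) (N : nat) (f : {poly K}) :
  reflect (forall k, (k < N)%N -> f`_k = 0) ('X^N %| f).
Proof.
apply: (iffP idP) => [/dvdpP[h ->] k ltkN|f0]; first by rewrite coefMXn ltkN.
rewrite -(poly_take_drop N f) dvdp_addl ?dvdp_mull //.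
suff -> : take_poly N f = 0 by rewrite dvdp0.
by apply/polyP=> k; rewrite coef_take_poly coef0; case: ltnP => // /f0.
Qed.

Lemma eq_modXn_expr (K : fieldType) (N j : nat) (f h : {poly K}) :
  'X^N %| f - h -> 'X^N %| f ^+ j - h ^+ j.
Proof. by move=> fh; rewrite subrXX dvdp_mulr. Qed.

(** Logarithmic derivatives add over the factors, and that of 1 - e X is minus the geometric series
    e / (1 - e X), truncated here at degree N. *)
Lemma prod_deriv_modXn (K : fieldType) (N : nat) (eta : seq K) :
  let L := \prod_(e <- eta) (1 - e *: 'X) in
  'X^N %| L^`() + L * \poly_(i < N) \sum_(e <- eta) e ^+ i.+1.
Proof.
elim: eta => [|e eta /= IH].
  rewrite /= big_nil derivC add0r mul1r; apply/dvdXnP=> k ltkN.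
  by rewrite coef_poly ltkN big_nil.
rewrite big_cons; set L := \prod_(e <- eta) _ in IH *.
set P := \poly_(i < N) _ in IH; set Q := \poly_(i < N) e ^+ i.+1.
have -> : \poly_(i < N) (\sum_(x <- e :: eta) x ^+ i.+1) = Q + P.
  by apply/polyP=> k; rewrite coefD !coef_poly; case: ifP; rewrite ?addr0 // big_cons.
have geomQ : (1 - e *: 'X) * Q = e%:P - e ^+ N.+1 *: 'X^N.
  apply/polyP=> k; rewrite mulrBl mul1r -scalerAl !coefE.
  case: k => [|k] /=.
    by case: N {IH P} @Q => [|N] /=; rewrite !expr1 ?(mulr0, mulr1, subr0, subrr).
  rewrite sub0r; case: (ltngtP k.+1 N) => [lt|gt|<-].
  - by rewrite -exprS subrr mulr0 oppr0.
  - by rewrite !mulr0 subrr oppr0.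
  by rewrite sub0r mulr1 -exprS.
have -> : ((1 - e *: 'X) * L)^`() + (1 - e *: 'X) * L * (Q + P)
   = (1 - e *: 'X) * (L^`() + L * P) + L * ((1 - e *: 'X) * Q - e%:P).
  by rewrite derivM derivB derivC derivZ derivX -(mul_polyC e 1); ring.
rewrite geomQ [e%:P - _ - _]addrAC subrr add0r dvdp_add ?(dvdp_mull _ IH) //.
by rewrite dvdp_mull // -scaleNr -mul_polyC dvdp_mull.
Qed.

(** [fps_exp] truncates anew for each coefficient; a single polynomial that is right up to degree N
    can be differentiated. *)
Definition exp_trunc (a : nat -> rat) (N : nat) : {poly rat} :=
  \sum_(j < N.+1) (j`!%:R)^-1 *: (\poly_(i < N.+1) a i) ^+ j.

Lemma dvdXn_poly_exp (a : nat -> rat) (N j : nat) :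
  a 0%N = 0 -> 'X^j %| (\poly_(i < N) a i) ^+ j.
Proof.
move=> a0; apply: dvdp_exp2r; rewrite -[X in X %| _]expr1.
by apply/dvdXnP=> -[|//] _; rewrite coef_poly a0 if_same.
Qed.

Lemma coef_exp_trunc (a : nat -> rat) (N k : nat) :
  a 0%N = 0 -> (k <= N)%N -> (exp_trunc a N)`_k = fps_exp a k.
Proof.
move=> a0 lekN; rewrite /exp_trunc /fps_exp !coef_sum.
rewrite (big_ord_widen_cond N.+1 xpredT
  (fun j => ((j`!%:R)^-1 *: (\poly_(i < k.+1) a i) ^+ j)`_k)) //.
rewrite [RHS]big_mkcond /=; apply: eq_bigr => j _; rewrite !coefZ.
case: ifPn => [_|]; last first.
  rewrite -leqNgt => ltkj.
  by rewrite (dvdXnP _ _ (dvdXn_poly_exp _ _ a0) _ ltkj) mulr0.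
congr (_ * _); apply/eqP; rewrite -subr_eq0 -coefB; apply/eqP.
apply: (dvdXnP k.+1 _ _ k (ltnSn k)); apply: eq_modXn_expr; apply/dvdXnP=> i.
by rewrite ltnS => leik; rewrite coefB !coef_poly !ltnS leik (leq_trans leik) // subrr.
Qed.

(** The differential equation of exp(A). The term of index j + 1 has as derivative A' times the term
    of index j, so the only error is a multiple of A^N, divisible by X^N as A has no constant
    term. *)
Lemma exp_trunc_deriv (a : nat -> rat) (N : nat) :
  a 0%N = 0 ->
  'X^N %| (exp_trunc a N)^`() - (\poly_(i < N.+1) a i)^`() * exp_trunc a N.
Proof.
move=> a0; rewrite /exp_trunc; set A := \poly_(i < _) _.
rewrite [X in X^`()]big_ord_recl [X in _ * X]big_ord_recr /=.
rewrite expr0 derivD derivZ derivC scaler0 add0r mulrDr.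
rewrite raddf_sum (_ : \sum_i _ = A^`() * \sum_(i < N) (i`!%:R)^-1 *: A ^+ i).
  rewrite opprD addrA subrr sub0r -mulrN -scaleNr dvdp_mull // -mul_polyC dvdp_mull //.
  exact: dvdXn_poly_exp.
rewrite mulr_sumr; apply: eq_bigr => i _.
rewrite /bump /= add1n derivZ deriv_exp /= -scaler_nat scalerA -scalerAr.
rewrite factS natrM invfM mulrAC mulVf ?mul1r //.
by rewrite pnatr_eq0.
Qed.

(* The L-polynomial and the product over the Weil numbers have the same
   logarithmic derivative modulo 'X^N. *)
Lemma weil_numbers_power_sum (R : realType) (F : finFieldType) (X : curve F)
    (eta : seq R[i]) (n : nat) :
  weil_numbers X eta -> (0 < n)%N ->
  (point_defect X n)%:~R = - \sum_(e <- eta) e ^+ n.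
Proof.
case: n => // n etaX _; set a := fun n => if n == 0%N then 0 else
  (point_defect X n)%:~R / n%:R : rat.
pose N := n.+1; pose L := \prod_(e <- eta) (1 - e *: 'X).
pose A := \poly_(i < N.+1) a i; pose P := \poly_(i < N) \sum_(e <- eta) e ^+ i.+1.
(* One degree more than N, since differentiation loses one. *)
have EL : 'X^(N.+1) %| map_poly ratr (exp_trunc a N) - L.
  apply/dvdXnP=> k; rewrite ltnS => lekN.
  by rewrite coefB coef_map coef_exp_trunc // -etaX subrr.
have dEL : 'X^N %| (map_poly ratr (exp_trunc a N) - L)^`().
  apply/dvdXnP=> k ltkN; rewrite coef_deriv (dvdXnP _ _ EL) ?mul0rn //.
have dE : 'X^N %| (map_poly ratr (exp_trunc a N)^`()
    - map_poly ratr A^`() * map_poly ratr (exp_trunc a N) :> {poly R[i]}).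
  rewrite -rmorphM -rmorphB -(map_polyXn (ratr : rat -> R[i])) dvdp_map.
  exact: exp_trunc_deriv.
have dL : 'X^N %| L^`() + L * P := prod_deriv_modXn _ _.
(* L has constant term 1, so it can be cancelled modulo X^N. *)
have L0 : coprimep 'X^N L.
  rewrite coprimep_expl // coprimep_sym coprimepX /root horner_prod.
  by rewrite big1 ?oner_eq0 // => e _; rewrite !hornerE subr0.
have /dvdXnP/(_ n (ltnSn n)) : 'X^N %| map_poly ratr A^`() + P.
  rewrite -(Gauss_dvdpr _ L0).
  have -> : L * (map_poly ratr A^`() + P) = (L^`() + L * P)
    - (map_poly ratr (exp_trunc a N)^`()
         - map_poly ratr A^`() * map_poly ratr (exp_trunc a N))
    + ((map_poly ratr (exp_trunc a N) - L)^`()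
       - map_poly ratr A^`() * (map_poly ratr (exp_trunc a N) - L)).
    by rewrite derivB deriv_map; ring.
  apply: dvdp_add; apply: dvdp_sub => //; apply: dvdp_mull.
  by apply: dvdp_trans EL; rewrite dvdp_exp2l.
(* Coefficient n of A' is (n + 1) [a n.+1], in which the denominator of [a] cancels. *)
rewrite coefD coef_map coef_deriv !coef_poly !ltnSn /a /= => /eqP.
rewrite addr_eq0 => /eqP <-; rewrite -[_ *+ _]mulr_natr divfK ?ratr_int //.
by rewrite pnatr_eq0.
Qed.

(** * Primitive roots of unity and their conjugates over the rationals *)

Lemma prim_root_exists (C : numClosedFieldType) (n : nat) :
  (0 < n)%N -> exists z : C, n.-primitive_root z.
Proof.
move=> n_gt0; have [r Dp] := closed_field_poly_normal ('X^n - 1 : {poly C}).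
rewrite (monicP _) ?monicXnsubC // scale1r in Dp.
have rn1 : all n.-unity_root r by apply/allP=> z; rewrite -root_prod_XsubC -Dp.
have sz_r : (n < (size r).+1)%N by rewrite -(size_prod_XsubC r id) -Dp size_XnsubC.
have [|z] := hasP (has_prim_root n_gt0 rn1 _ sz_r); last by exists z.
by rewrite -separable_prod_XsubC -Dp separable_Xn_sub_1 // pnatr_eq0 -lt0n.
Qed.

(** As X^n - 1 is the product of the ['Phi_d] with d dividing n, z is a root of one of them; then
    z^d = 1, which forces d = n. *)
Lemma root_Cyclotomic (F : numFieldType) (n : nat) (z : F) :
  n.-primitive_root z -> root (map_poly intr 'Phi_n) z.
Proof.
move=> zn; have n_gt0 := prim_order_gt0 zn.
have: root (map_poly intr (\prod_(d <- divisors n) 'Phi_d)) z.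
  rewrite prod_Cyclotomic // rmorphB rmorph1 /= map_polyXn.
  exact/unity_rootP/prim_expr_order.
rewrite rmorph_prod rootE horner_prod prodf_seq_eq0 => /hasP[d d_dvd /= zd].
suff -> : n = d by [].
have dn : (d %| n)%N by rewrite dvdn_divisors.
apply/eqP; rewrite eqn_dvd dn andbT (prim_order_dvd zn) -subr_eq0.
have d_gt0 := dvdn_gt0 n_gt0 dn.
have : root (map_poly intr (\prod_(e <- divisors d) 'Phi_e)) z.
  rewrite rmorph_prod rootE horner_prod prodf_seq_eq0; apply/hasP; exists d => //.
  by rewrite -dvdn_divisors.
by rewrite prod_Cyclotomic // rmorphB rmorph1 /= map_polyXn rootE !hornerE.
Qed.

(* Conjugation by the Galois group of the cyclotomic field: 'Phi_n is
   irreducible over rat because it is the minimal polynomial of each of its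
   roots in algC. *)
Lemma root_conj_prim_root (C : numFieldType) (n t : nat) (z : C) (f : {poly rat}) :
  n.-primitive_root z -> coprime t n ->
  root (map_poly ratr f) z -> root (map_poly ratr f) (z ^+ t).
Proof.
move=> zn cotn fz; pose Phi : {poly rat} := map_poly intr 'Phi_n.
have PhiE (L : numFieldType) : map_poly ratr Phi = map_poly intr 'Phi_n :> {poly L}.
  by rewrite -map_poly_comp; apply: eq_map_poly => k /=; rewrite ratr_int.
have Phi0 : Phi != 0.
  by rewrite map_poly_eq0_id0 ?intr_eq0 ?lead_coef_eq0 ?monic_neq0 ?Cyclotomic_monic.
(* The gcd carries the question from C over to [algC]: it has the root z, hence is not constant,
   hence has a root in [algC]. *)
pose D := gcdp f Phi.
have Dz : root (map_poly ratr D) z.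
  by rewrite gcdp_map root_gcd fz PhiE root_Cyclotomic.
have D0 : D != 0 by rewrite gcdp_eq0 negb_and Phi0 orbT.
have [y Dy] : exists y : algC, root (map_poly ratr D) y.
  apply/closed_rootP; rewrite size_map_poly.
  rewrite -(size_map_poly (ratr : rat -> C)) neq_ltn.
  by rewrite (root_size_gt1 _ Dz) ?orbT // map_poly_eq0.
move: Dy; rewrite gcdp_map root_gcd => /andP[fy Phiy].
have [w wn] := C_prim_root_exists (prim_order_gt0 zn).
have yn : n.-primitive_root y.
  by rewrite -(root_cyclotomic wn) -(Cintr_Cyclotomic wn) -PhiE.
have [p [pE _] p_dvd] := minCpolyP y.
have : Phi %| f.
  rewrite -(dvdp_map (ratr : rat -> algC)) PhiE (Cintr_Cyclotomic yn).
  by rewrite -(minCpoly_cyclotomic yn) pE dvdp_map -p_dvd.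
rewrite -(dvdp_map (ratr : rat -> C)) PhiE => /dvdpP[h ->].
by rewrite rootM root_Cyclotomic ?orbT // prim_root_exp_coprime.
Qed.

(** * Squares and nonsquares in a finite field *)

Section SquareFibres.
Variable F : finFieldType.
Implicit Types a x y : F.

Definition square_fibre a y : {set F} := [set x | a * x ^+ 2 == y].

Lemma card_square_fibre_le a y : a != 0 -> (#|square_fibre a y| <= 2)%N.
Proof.
move=> a0; case: (set_0Vmem (square_fibre a y)) => [->|[x]]; first by rewrite cards0.
rewrite inE => /eqP ax; apply: leq_trans (_ : #|[set x; - x]| <= 2)%N.
  apply/subset_leq_card/subsetP=> x'; rewrite !inE -ax => /eqP/(mulfI a0)/eqP.
  by rewrite eqf_sqr.
by rewrite cards2; case: (_ != _).
Qed.

(* The sum is at most 2 for every y, and its total over y is 2 * #|F|. *)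
Lemma card_square_fibres (a : F) : a != 0 -> ~ (exists x, x ^+ 2 = a) ->
  forall y, (#|square_fibre 1%R y| + #|square_fibre a y| = 2)%N.
Proof.
move=> a0 nsq_a.
have sum_fibre b : (\sum_y #|square_fibre b y| = #|F|)%N.
  transitivity (\sum_(x : F) 1)%N; last by rewrite sum_nat_const muln1.
  rewrite [RHS](partition_big (fun x => b * x ^+ 2) xpredT) //=.
  by apply: eq_bigr => y _; rewrite -sum1_card; apply: eq_bigl => x; rewrite inE.
have le2 y : (#|square_fibre 1%R y| + #|square_fibre a y| <= 2)%N.
  have [->|y0] := eqVneq y 0.
    have fibre0 b : b != 0 -> #|square_fibre b 0| = 1%N.
      move=> b0; rewrite -(cards1 (0 : F)); apply: eq_card => x.
      by rewrite !inE mulf_eq0 expf_eq0 /= (negbTE b0).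
    by rewrite !fibre0 ?oner_eq0.
  case: (set_0Vmem (square_fibre 1%R y)) => [->|[x]].
    by rewrite cards0 card_square_fibre_le.
  case: (set_0Vmem (square_fibre a y)) => [->|[x' ]].
    by rewrite cards0 addn0 card_square_fibre_le ?oner_eq0.
  rewrite !inE mul1r => /eqP ax' /eqP xy; case: nsq_a; exists (x / x').
  have x'0 : x' != 0 by apply: contraNneq y0 => x'0; rewrite -ax' x'0 expr0n mulr0.
  by rewrite expr_div_n xy -ax' mulfK // expf_neq0.
move=> y; apply/eqP; rewrite eqn_leq le2 /= leqNgt; apply/negP => lt2.
have : (\sum_y (#|square_fibre 1%R y| + #|square_fibre a y|) < \sum_(y : F) 2)%N.
  rewrite (bigD1 y) //= [X in (_ < X)%N](bigD1 y) //= -addSn.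
  by rewrite leq_add // leq_sum.
by rewrite big_split /= !sum_fibre sum_nat_const muln2 addnn ltnn.
Qed.

(** If y is not a square, both elements counted by [card_square_fibres] lie in the fibre of a. *)
Lemma square_or_fibre (a y : F) : a != 0 -> ~ (exists x, x ^+ 2 = a) ->
  ~ (exists x, x ^+ 2 = y) -> exists x, a * x ^+ 2 = y.
Proof.
move=> a0 nsq_a nsq_y; have := card_square_fibres a0 nsq_a y.
case: (set_0Vmem (square_fibre 1%R y)) => [->|[x]]; last first.
  by rewrite inE mul1r => /eqP xy; case: nsq_y; exists x.
case: (set_0Vmem (square_fibre a y)) => [->|[x]]; first by rewrite cards0.
by rewrite inE => /eqP <-; exists x.
Qed.

End SquareFibres.

(** * Quadratic Gauss sums over the prime field *)

Section GaussSum.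
Variables (K : numFieldType) (p : nat) (z : K).
Hypotheses (p_pr : prime p) (p_odd : odd p) (zp : p.-primitive_root z).

Let two_neq0 : 2%:R != 0 :> 'F_p.
Proof.
have := prime_gt1 p_pr; rewrite -(dvdn_pcharf (pchar_Fp p_pr)) => p1.
by rewrite dvdn_prime2 //; apply: contraTneq p_odd => ->.
Qed.

Definition add_char (x : 'F_p) : K := z ^+ (x : nat).

Lemma add_char_natr n : add_char n%:R = z ^+ n.
Proof. by rewrite /add_char val_Fp_nat // prim_expr_mod. Qed.

Lemma add_charD : {morph add_char : x y / x + y >-> x * y}.
Proof. by move=> x y; rewrite -[x]natr_Zp -[y]natr_Zp -natrD !add_char_natr exprD. Qed.

Lemma sum_add_char : \sum_x add_char x = 0.
Proof.
have z1 : z != 1 by rewrite -[z]expr1 -(prim_order_dvd zp) dvdn1 gtn_eqF ?prime_gt1.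
apply: (mulfI (_ : 1 - z != 0)); first by rewrite subr_eq0 eq_sym.
rewrite mulr0 mulrBl mul1r mulr_sumr; apply/eqP; rewrite subr_eq0; apply/eqP.
rewrite (reindex_inj (addIr 1)) /=; apply: eq_bigr => x _.
by rewrite add_charD mulrC -[1]/(1%:R) add_char_natr.
Qed.

Lemma sum_add_charM a : \sum_x add_char (a * x) = if a == 0 then p%:R else 0.
Proof.
have [->|a0] := eqVneq a 0.
  rewrite (eq_bigr (fun => 1)) => [|x _]; last by rewrite mul0r.
  by rewrite sumr_const card_Fp.
apply: etrans sum_add_char.
by rewrite [RHS](reindex_inj (mulfI a0)).
Qed.

(** For a != 0 this equals the Gauss sum of the quadratic character; this form requires no
    multiplicative character. *)
Definition gauss_sum (a : 'F_p) : K := \sum_x add_char (a * x ^+ 2).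

Lemma gauss_sum_fibre a :
  gauss_sum a = \sum_y add_char y *+ #|square_fibre a y|.
Proof.
rewrite /gauss_sum (partition_big (fun x => a * x ^+ 2) xpredT) //=.
apply: eq_bigr => y _; rewrite -sumr_const; apply: eq_big => [x|x /eqP-> //].
by rewrite inE.
Qed.

Lemma gauss_sumM_sqr a u : u != 0 -> gauss_sum (a * u ^+ 2) = gauss_sum a.
Proof.
move=> u0; rewrite /gauss_sum [RHS](reindex_inj (mulfI u0)); apply: eq_bigr => x _.
by rewrite -[_ * u ^+ 2 * _]mulrA exprMn.
Qed.

(** The two fibres over each y have 2 elements together, so the two Gauss sums add up to twice the
    full character sum, which is 0. *)
Lemma gauss_sum_nonsquare a : a != 0 -> ~ (exists x, x ^+ 2 = a) ->
  gauss_sum a = - gauss_sum 1.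
Proof.
move=> a0 nsq_a; apply/eqP; rewrite -addr_eq0 addrC !gauss_sum_fibre -big_split /=.
rewrite (eq_bigr (fun y => add_char y *+ 2)) => [|y _].
  by rewrite sumrMnl sum_add_char mul0rn.
by rewrite -mulrnDr (card_square_fibres a0 nsq_a).
Qed.

(** With x = y + d the exponent x^2 - y^2 becomes d^2 + 2 d y, and the sum over y vanishes unless d
    = 0. *)
Lemma gauss_sum_norm : gauss_sum 1 * gauss_sum (- 1) = p%:R.
Proof.
rewrite /gauss_sum mulr_suml.
transitivity (\sum_d \sum_y add_char (d ^+ 2) * add_char (2%:R * d * y)).
  under eq_bigr do rewrite mulr_sumr; rewrite exchange_big /=.
  rewrite [RHS]exchange_big /=; apply: eq_bigr => y _.
  rewrite (reindex_inj (addIr y)) /=; apply: eq_bigr => d _.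
  by rewrite -!add_charD; congr add_char; ring.
under eq_bigr => d _ do rewrite -mulr_sumr sum_add_charM mulf_eq0 (negbTE two_neq0).
rewrite (bigD1 0) //= expr0n /= big1 => [|d /negbTE->]; last by rewrite mulr0.
by rewrite addr0 (_ : add_char 0 = 1) ?mul1r.
Qed.

(** Multiplicativity of the quadratic character at -1 and a, written without division. *)
Lemma gauss_sumN a :
  a != 0 -> gauss_sum 1 * gauss_sum (- a) = gauss_sum a * gauss_sum (- 1).
Proof.
move=> a0; case: (pickP (fun x => x ^+ 2 == a)) => [u /eqP ua|nsq].
  have u0 : u != 0 by apply: contraNneq a0 => u0; rewrite -ua u0 expr0n.
  by rewrite -{1}[- a]mulN1r -ua gauss_sumM_sqr // -[u ^+ 2]mul1r gauss_sumM_sqr.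
have nsq_a : ~ exists x, x ^+ 2 = a by case=> x /eqP; rewrite nsq.
have N1_neq0 : -1 != 0 :> 'F_p by rewrite oppr_eq0 oner_eq0.
rewrite (gauss_sum_nonsquare a0 nsq_a) mulNr -mulrN; congr (_ * _).
case: (pickP (fun x : 'F_p => x ^+ 2 == -1)) => [u /eqP u1|nsqN1].
  have u0 : u != 0 by apply: contraNneq N1_neq0 => u0; rewrite -u1 u0 expr0n.
  rewrite -[- a]mulrN1 -[gauss_sum (-1)](gauss_sumM_sqr _ u0) u1 mulrNN mul1r.
  by rewrite -{1}u1 gauss_sumM_sqr // gauss_sum_nonsquare.
have nsq_N1 : ~ exists x : 'F_p, x ^+ 2 = -1 by case=> x /eqP; rewrite nsqN1.
(* When -1 and a are both nonsquares, a = - x^2, so - a is a square. *)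
have [x xa] := square_or_fibre N1_neq0 nsq_N1 nsq_a.
have x0 : x != 0 by apply: contraNneq a0 => x0; rewrite -xa x0 expr0n mulr0.
rewrite -xa mulN1r opprK -[x ^+ 2]mul1r gauss_sumM_sqr //.
by rewrite (gauss_sum_nonsquare N1_neq0) ?opprK.
Qed.

End GaussSum.

(** * Gauss sums and the Legendre symbol *)

Lemma legendre_Fp (p : nat) (a : int) : prime p -> ~~ (p %| a)%Z ->
  legendre a p = if [exists x : 'F_p, x ^+ 2 == a%:~R] then 1 else -1.
Proof.
move=> p_pr pNa.
have FpE (b c : int) : (b%:~R == c%:~R :> 'F_p) = (b == c %[mod p])%Z.
  rewrite eqz_mod_dvd -subr_eq0 -rmorphB.
  case: (b - c) => n; rewrite ?NegzE ?rmorphN /= ?oppr_eq0 -?pmulrn.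
    by rewrite -(dvdn_pcharf (pchar_Fp p_pr)).
  by rewrite -(dvdn_pcharf (pchar_Fp p_pr)) dvdzE.
rewrite /legendre (negbTE pNa); congr (if _ then _ else _).
apply/existsP/existsP => -[x xa].
  by exists (x : nat)%:R; rewrite -[_%:R]/((x : nat)%:Z%:~R) -rmorphXn FpE.
have ltxp : (x < p)%N by rewrite -[X in (_ < X)%N](Fp_cast p_pr).
exists (Ordinal ltxp); rewrite -FpE rmorphXn /=.
by rewrite -pmulrn natr_Zp.
Qed.

Lemma intr_Fp_neq0 (p : nat) (a : int) : prime p -> ~~ (p %| a)%Z -> a%:~R != 0 :> 'F_p.
Proof.
move=> p_pr; apply: contraNneq; case: a => n; rewrite ?NegzE ?rmorphN /= => /eqP.
  by rewrite -pmulrn -(dvdn_pcharf (pchar_Fp p_pr)).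
by rewrite oppr_eq0 -pmulrn -(dvdn_pcharf (pchar_Fp p_pr)) dvdzE.
Qed.

Section GaussLegendre.
Variables (K : numFieldType) (p : nat) (z : K).
Hypotheses (p_pr : prime p) (p_odd : odd p) (zp : p.-primitive_root z).

Lemma gauss_sum_legendre (a : int) : ~~ (p %| a)%Z ->
  gauss_sum z (a%:~R : 'F_p) = (legendre a p)%:~R * gauss_sum z (1 : 'F_p).
Proof.
move=> pNa; have a0 := intr_Fp_neq0 p_pr pNa.
rewrite legendre_Fp //; case: ifPn => [/existsP[u /eqP ua]|/existsPn nsq].
  have u0 : u != 0 by apply: contraNneq a0 => u0; rewrite -ua u0 expr0n.
  by rewrite -ua -[u ^+ 2]mul1r gauss_sumM_sqr // mul1r.
rewrite mulN1r; apply: gauss_sum_nonsquare => // -[x /eqP xa].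
by have := nsq x; rewrite xa.
Qed.

Lemma gauss_sum1_neq0 : gauss_sum z (1 : 'F_p) != 0.
Proof.
apply/eqP => g0; have /eqP := gauss_sum_norm p_pr p_odd zp.
by rewrite g0 mul0r eq_sym pnatr_eq0 eqn0Ngt prime_gt0.
Qed.

Lemma gauss_sumN1 :
  gauss_sum z (-1 : 'F_p) = gauss_sum z (1 : 'F_p) \/
  gauss_sum z (-1 : 'F_p) = - gauss_sum z (1 : 'F_p).
Proof.
have pN1 : ~~ (p %| -1)%Z by rewrite dvdzE /= dvdn1 gtn_eqF ?prime_gt1.
have := gauss_sum_legendre pN1; rewrite legendre_Fp // rmorphN1.
by case: ifP => _ ->; rewrite ?mul1r ?mulN1r; [left|right].
Qed.

(** Each factor -1 inside the symbol is traded by [gauss_sumN] for the quotient of the Gauss sums at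
    -1 and 1. With k = (t - 1) / 2 this is the sign in the theorem. *)
Lemma gauss_sum_sign_legendre (k t : nat) : ~~ (p %| t)%N ->
  gauss_sum z (1 : 'F_p) ^+ k
    * ((legendre ((-1) ^+ k * t%:Z) p)%:~R * gauss_sum z (1 : 'F_p))
  = gauss_sum z (-1 : 'F_p) ^+ k * gauss_sum z (t%:R : 'F_p).
Proof.
move=> pNt; have pN b : ~~ (p %| (-1) ^+ b * t%:Z)%Z.
  by rewrite dvdzE abszM abszX exp1n mul1n.
rewrite -gauss_sum_legendre //; elim: k => [|k IH].
  by rewrite !expr0 !mul1r -pmulrn.
have := gauss_sumN p_pr zp (intr_Fp_neq0 p_pr (pN k)) => NG.
rewrite exprS [(-1) ^+ k.+1]exprS mulN1r mulNr rmorphN /=.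
by rewrite -mulrA mulrCA NG mulrA IH mulrAC -exprSr.
Qed.

End GaussLegendre.

(** * A square root of p in a cyclotomic field, and its conjugates *)

Lemma expi_odd (K : idomainType) (i : K) (t : nat) :
  i ^+ 2 = -1 -> odd t -> i ^+ t = (-1) ^+ ((t - 1) %/ 2) * i.
Proof.
move=> i2 todd; rewrite -i2 -exprM -exprSr; congr (_ ^+ _); lia.
Qed.

Lemma prim_root_half (K : idomainType) (n : nat) (z : K) :
  (0 < n)%N -> (n * 2).-primitive_root z -> z ^+ n = -1.
Proof.
move=> n0 zn; have : (z ^+ n) ^+ 2 == 1 by rewrite -exprM prim_expr_order.
rewrite sqrf_eq1 => /orP[|/eqP//]; rewrite -(prim_order_dvd zn) => /dvdn_leq.
by lia.
Qed.

(** z + z^7 = z + 1/z is a square root of 2; it is kept for t = 1, 7 modulo 8 and negated for t = 3,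
    5. *)
Lemma eighth_root_conj (K : idomainType) (z : K) (t : nat) :
  8.-primitive_root z -> odd t ->
  z ^+ t + z ^+ (7 * t) = (-1) ^+ ((t ^ 2 - 1) %/ 8) * (z + z ^+ 7).
Proof.
move=> z8 todd; have z4 : z ^+ 4 = -1 by apply: prim_root_half.
have -> : z ^+ 7 = - z ^+ 3 by rewrite (exprD z 4 3) z4 mulN1r.
rewrite -(prim_expr_mod z8 t) -(prim_expr_mod z8 (7 * t)) -signr_odd.
have : [\/ t %% 8 = 1, t %% 8 = 3, t %% 8 = 5 | t %% 8 = 7]%N.
  have : (t %% 8 < 8)%N by rewrite ltn_mod.
  have : odd (t %% 8) by rewrite (odd_mod t (erefl : odd 8 = false)).
  by case: (t %% 8)%N => [|[|[|[|[|[|[|[|]]]]]]]] // _ _; constructor.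
have z5 : z ^+ 5 = - z by rewrite (exprD z 4 1) z4 mulN1r.
have z7 : z ^+ 7 = - z ^+ 3 by rewrite (exprD z 4 3) z4 mulN1r.
(* This turns (t^2 - 1) / 8 into a polynomial in k whose parity is that of its constant term. *)
have [k tE] : exists k, t = (8 * k + t %% 8)%N by exists (t %/ 8)%N; lia.
case=> tm; rewrite tm in tE *; rewrite tE.
- rewrite (_ : (7 * _) %% 8 = 7)%N; last by lia.
  rewrite (_ : ((_ ^ 2 - 1) %/ 8) = (8 * k ^ 2 + 2 * k))%N; last by nia.
  by rewrite (_ : odd _ = false) ?expr0 ?mul1r ?z7 ?expr1 //; lia.
- rewrite (_ : (7 * _) %% 8 = 5)%N; last by lia.
  rewrite (_ : ((_ ^ 2 - 1) %/ 8) = (8 * k ^ 2 + 6 * k + 1))%N; last by nia.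
  by rewrite (_ : odd _ = true) ?expr1 ?z5; [ring | lia].
- rewrite (_ : (7 * _) %% 8 = 3)%N; last by lia.
  rewrite (_ : ((_ ^ 2 - 1) %/ 8) = (8 * k ^ 2 + 10 * k + 3))%N; last by nia.
  by rewrite (_ : odd _ = true) ?expr1 ?z5; [ring | lia].
rewrite (_ : (7 * _) %% 8 = 1)%N; last by lia.
rewrite (_ : ((_ ^ 2 - 1) %/ 8) = (8 * k ^ 2 + 14 * k + 6))%N; last by nia.
by rewrite (_ : odd _ = false) ?expr0 ?mul1r ?z7 ?expr1; [ring | lia].
Qed.

(** For odd t prime to p this is the Jacobi symbol (p / t), by quadratic reciprocity and its
    supplement for 2. *)
Definition sqrt_prime_sign (p t : nat) : int :=
  if odd p then legendre ((-1) ^+ ((t - 1) %/ 2) * t%:Z) p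
  else (-1) ^+ ((t ^ 2 - 1) %/ 8).

(** W writes a square root of p as a polynomial in w: the Gauss sum G or i G if p is odd, z + z^7
    with z of order 8 if p = 2. The factor 8 p of M provides these roots of unity. *)
Lemma sqrt_prime_cyclotomic (K : numFieldType) (p M : nat) (w : K) :
  prime p -> M.-primitive_root w -> (8 * p %| M)%N ->
  exists2 W : {poly rat}, (map_poly ratr W).[w] ^+ 2 = p%:R
    & forall t, odd t -> ~~ (p %| t)%N ->
        (map_poly ratr W).[w ^+ t] = (sqrt_prime_sign p t)%:~R * (map_poly ratr W).[w].
Proof.
move=> p_pr wM dM; rewrite /sqrt_prime_sign.
have hornerXn k (x : K) : (map_poly ratr ('X^k : {poly rat})).[x] = x ^+ k.
  by rewrite map_polyXn hornerXn.
case: (boolP (odd p)) => [p_odd|p_even].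
  have pM : (p %| M)%N by apply: dvdn_trans dM; apply: dvdn_mull.
  have M4 : (2 * 2 %| M)%N.
    by apply: dvdn_trans dM; rewrite dvdn_mulr.
  pose z := w ^+ (M %/ p); have zp : p.-primitive_root z := dvdn_prim_root wM pM.
  pose i := w ^+ (M %/ (2 * 2)).
  have i2 : i ^+ 2 = -1 by apply/prim_root_half/(dvdn_prim_root wM M4).
  pose G : {poly rat} := \sum_(x : 'F_p) 'X^(M %/ p * (x : nat) ^ 2).
  have GE t : (map_poly ratr G).[w ^+ t] = gauss_sum z (t%:R : 'F_p).
    rewrite rmorph_sum horner_sum; apply: eq_bigr => x _; rewrite hornerXn.
    rewrite -[in RHS](natr_Zp x) -natrX -natrM add_char_natr //.
    by rewrite -!exprM; congr (w ^+ _); lia.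
  have GE1 : (map_poly ratr G).[w] = gauss_sum z (1 : 'F_p) by exact: (GE 1%N).
  have G0 := gauss_sum1_neq0 p_pr p_odd zp.
  case: (gauss_sumN1 p_pr zp) => GN1.
    exists G; first by rewrite GE1 -(gauss_sum_norm p_pr p_odd zp) GN1.
    move=> t todd pNt; rewrite GE GE1.
    have := gauss_sum_sign_legendre p_pr zp ((t - 1) %/ 2) pNt.
    by rewrite GN1 => /(mulfI (expf_neq0 _ G0)) ->.
  (* Here G^2 = - p, so G is multiplied by i; the sign in i^t = (-1)^((t-1)/2) i cancels the one
     that G(-1) = - G(1) brings in. *)
  exists ('X^(M %/ (2 * 2)) * G).
    rewrite rmorphM hornerM hornerXn GE1 exprMn i2 mulN1r.
    by rewrite -(gauss_sum_norm p_pr p_odd zp) GN1 mulrN.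
  move=> t todd pNt; rewrite rmorphM !hornerM !hornerXn GE GE1 exprAC -/i expi_odd //.
  have := gauss_sum_sign_legendre p_pr zp ((t - 1) %/ 2) pNt.
  rewrite GN1 [(- gauss_sum _ _) ^+ _]exprNn -[RHS]mulrA [RHS]mulrCA.
  move=> /(mulfI (expf_neq0 _ G0)) GL.
  by rewrite mulrAC -GL mulrAC mulrA.
have p2 : p = 2 by case/even_prime: p_pr => // H; rewrite H in p_even.
have M8 : (8 %| M)%N by apply: dvdn_trans dM; apply: dvdn_mulr.
pose z := w ^+ (M %/ 8); have z8 : 8.-primitive_root z := dvdn_prim_root wM M8.
have z4 : z ^+ 4 = -1 by apply: prim_root_half.
pose W : {poly rat} := 'X^(M %/ 8) + 'X^(M %/ 8 * 7).
have WE t : (map_poly ratr W).[w ^+ t] = z ^+ t + z ^+ (7 * t).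
  rewrite rmorphD hornerD !hornerXn /z -!exprM.
  by congr (_ ^+ _ + _ ^+ _); lia.
have WE1 : (map_poly ratr W).[w] = z + z ^+ 7 by exact: (WE 1%N).
exists W; last by move=> t todd _; rewrite WE WE1 eighth_root_conj // rmorphXn rmorphN1.
rewrite WE1 p2 (exprD z 4 3) z4.
transitivity (z ^+ 2 - 2%:R * z ^+ 4 + z ^+ 4 * z ^+ 2); first by ring.
by rewrite z4; ring.
Qed.

(** * Conjugation of sums of roots of unity *)

(** All of [ys] are powers of w, so the hypothesis on their sum says that w is a root of a rational
    polynomial; then w^t is a root too. *)
Lemma power_sum_conj (C : numFieldType) (M N t : nat) (w : C) (ys : seq C)
    (W : {poly rat}) :
  M.-primitive_root w -> (N %| M)%N -> coprime t M ->
  (forall y, y \in ys -> y ^+ N = 1) ->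
  \sum_(y <- ys) y = (map_poly ratr W).[w] ->
  \sum_(y <- ys) y ^+ t = (map_poly ratr W).[w ^+ t].
Proof.
move=> wM /dvdnP[k Mk] cotM ysN sumW.
have [ks ysE] : exists ks : seq nat, ys = [seq w ^+ j | j <- ks].
  elim: ys ysN {sumW} => [|y ys IH] ysN; first by exists [::].
  have [|ks ->] := IH; first by move=> x xys; apply: ysN; rewrite inE xys orbT.
  have yM : y ^+ M = 1 by rewrite Mk mulnC exprM ysN ?expr1n // mem_head.
  by have [i ->] := prim_rootP wM yM; exists (nat_of_ord i :: ks).
pose f : {poly rat} := (\sum_(j <- ks) 'X^j) - W.
have fE (x : C) : (map_poly ratr f).[x] = (\sum_(j <- ks) x ^+ j) - (map_poly ratr W).[x].
  rewrite rmorphB rmorph_sum hornerD hornerN horner_sum; congr (_ - _).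
  by apply: eq_bigr => j _ /=; rewrite map_polyXn hornerXn.
have /(root_conj_prim_root wM cotM) : root (map_poly ratr f) w.
  by rewrite rootE fE -sumW ysE big_map subrr.
rewrite rootE fE subr_eq0 => /eqP <-; rewrite ysE big_map.
by apply: eq_bigr => j _; rewrite exprAC.
Qed.

Lemma rat_sum_roots_conj (C : numClosedFieldType) (N t : nat) (ys : seq C) (c : rat) :
  (0 < N)%N -> coprime t N -> (forall y, y \in ys -> y ^+ N = 1) ->
  \sum_(y <- ys) y = ratr c -> \sum_(y <- ys) y ^+ t = \sum_(y <- ys) y.
Proof.
move=> N0 cotN ysN sumc; have [w wN] := prim_root_exists C N0.
have cE (x : C) : (map_poly ratr c%:P).[x] = ratr c :> C by rewrite map_polyC hornerC.
by rewrite (@power_sum_conj _ N N t w ys c%:P) ?cE.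
Qed.

Lemma sqrt_sum_roots_conj (C : numClosedFieldType) (p N t : nat) (ys : seq C)
    (b : rat) (P : C) :
  prime p -> (0 < N)%N -> odd t -> ~~ (p %| t)%N -> coprime t N ->
  (forall y, y \in ys -> y ^+ N = 1) -> P ^+ 2 = p%:R ->
  \sum_(y <- ys) y = ratr b * P ->
  \sum_(y <- ys) y ^+ t = (sqrt_prime_sign p t)%:~R * \sum_(y <- ys) y.
Proof.
move=> p_pr N0 todd pNt cotN ysN P2 sumb.
have p0 := prime_gt0 p_pr; have M0 : (0 < 8 * p * N)%N by rewrite !muln_gt0 p0.
have [w wM] := prim_root_exists C M0.
have [W0 W2 Wsign] := sqrt_prime_cyclotomic p_pr wM (dvdn_mulr _ (dvdnn _)).
(* P and the value of W0 at w are square roots of the same p, so they agree up to sign. *)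
have [c PE] : exists c : rat, P = ratr c * (map_poly ratr W0).[w].
  have /eqP := etrans P2 (esym W2); rewrite eqf_sqr => /orP[] /eqP ->.
    by exists 1; rewrite rmorph1 mul1r.
  by exists (-1); rewrite rmorphN1 mulN1r.
have WE (x : C) : (map_poly ratr ((b * c) *: W0)).[x]
    = ratr (b * c) * (map_poly ratr W0).[x] :> C.
  by rewrite map_polyZ hornerZ.
have sumW : \sum_(y <- ys) y = (map_poly ratr ((b * c) *: W0)).[w].
  by rewrite WE sumb PE rmorphM mulrA.
have cotM : coprime t (8 * p * N).
  have cot8 : coprime t 8 by apply: (@coprimeXr 3 t 2); rewrite coprimen2.
  by rewrite !coprimeMr cotN cot8 andbT /= coprime_sym prime_coprime.
rewrite (power_sum_conj wM _ cotM ysN sumW) ?dvdn_mull // sumW !WE Wsign //.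
by rewrite mulrCA.
Qed.

(** Irrationality of the square root of p: otherwise p would be the square of c / b, against the
    parity of p-adic valuations. *)
Lemma ratr_sqrt_prime_eq0 (C : numFieldType) (p : nat) (b c : rat) (P : C) :
  prime p -> P ^+ 2 = p%:R -> ratr c = ratr b * P -> b = 0.
Proof.
move=> p_pr P2 cbP; apply/eqP/negPn/negP => b0.
have : ratr ((c / b) ^+ 2) = ratr p%:R :> C.
  by rewrite rmorphXn fmorph_div /= ratr_nat cbP mulrC mulKf ?fmorph_eq0.
move/fmorph_inj; set x := c / b => xp; have : numq x ^+ 2 = p%:Z * denq x ^+ 2.
  by apply: (@intr_inj rat); rewrite rmorphXn rmorphM rmorphXn /= numqE exprMn xp -pmulrn.
move=> /(congr1 absz); rewrite abszM !abszX absz_nat => /(congr1 (logn p)).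
rewrite lognM ?expn_gt0 ?absz_gt0 ?denq_neq0 ?prime_gt0 //.
by rewrite (logn_prime _ p_pr) eqxx !lognX; lia.
Qed.

(** Otherwise squaring would be onto, hence injective on a finite set, yet 1 and -1 have the same
    square. *)
Lemma nonsquare_exists (p : nat) : prime p -> odd p ->
  exists a : 'F_p, ~~ [exists x : 'F_p, x ^+ 2 == a].
Proof.
move=> p_pr p_odd; apply/existsP; apply: contraPT isT => /existsPn all_sq.
have [|g gK] := @fin_all_exists 'F_p (fun=> 'F_p) (fun a x => x ^+ 2 = a).
  by move=> a; have := all_sq a; rewrite negbK => /existsP[x /eqP]; exists x.
have inj_sq : injective (fun x : 'F_p => x ^+ 2) := can_inj (canF_sym gK).
have /inj_sq/eqP : (1 : 'F_p) ^+ 2 = (-1) ^+ 2 by rewrite sqrrN.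
rewrite -subr_eq0 opprK -[1 + 1]/(2%:R) -(dvdn_pcharf (pchar_Fp p_pr)).
by rewrite dvdn_prime2 // => /eqP p2; rewrite p2 in p_odd.
Qed.

(** The Chinese remainder theorem gives u = 1 modulo 4 N that is a nonsquare modulo p. Raising to
    the power u fixes every y but negates the square root of p, so the sum equals its opposite. *)
Lemma sqrt_sum_roots_eq0 (C : numClosedFieldType) (p N : nat) (ys : seq C)
    (b : rat) (P : C) :
  prime p -> odd p -> (0 < N)%N -> ~~ (p %| N)%N ->
  (forall y, y \in ys -> y ^+ N = 1) -> P ^+ 2 = p%:R ->
  \sum_(y <- ys) y = ratr b * P -> \sum_(y <- ys) y = 0.
Proof.
move=> p_pr p_odd N0 pNN ysN P2 sumb; have [a nsq_a] := nonsquare_exists p_pr p_odd.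
have co4N : coprime (4 * N) p.
  have co4p : coprime 4 p by apply: (@coprimeXl 2 2 p); rewrite coprime2n.
  by rewrite coprimeMl co4p coprime_sym prime_coprime.
have [u u1 ua] : exists2 u, u = 1 %[mod 4 * N] & u%:R = a.
  exists (chinese (4 * N) p 1 a); first exact: chinese_modl.
  apply/val_inj; rewrite /= val_Fp_nat // (chinese_modr co4N) modn_small //.
  by rewrite -[X in (_ < X)%N](Fp_cast p_pr).
have u1N k : (k %| 4 * N)%N -> u = 1 %[mod k].
  by move=> kN; rewrite -(modn_dvdm _ kN) u1 modn_dvdm.
(* As u = 1 modulo 4, (u - 1) / 2 is even and the sign is the Legendre symbol of u itself. *)
have [k uE] : exists k, u = (2 * k * 2).+1.
  have u14 : u = 1 %[mod 4] by apply: u1N; rewrite dvdn_mulr.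
  by exists (u %/ 4)%N; rewrite {1}(divn_eq u 4) u14 addn1 mulnAC mulnC.
have u_odd : odd u by rewrite uE /= oddM andbF.
have pNu : ~~ (p %| u)%N.
  rewrite (dvdn_pcharf (pchar_Fp p_pr)) ua; apply: contraNneq nsq_a => ->.
  by apply/existsP; exists 0; rewrite expr0n.
have couN : coprime u N by rewrite -coprime_modl u1N ?dvdn_mull // coprime_modl coprime1n.
have := sqrt_sum_roots_conj p_pr N0 u_odd pNu couN ysN P2 sumb.
rewrite /sqrt_prime_sign p_odd (_ : (u - 1) %/ 2 = 2 * k)%N; last by rewrite uE subn1 mulnK.
rewrite -signr_odd oddM /=.
rewrite expr0 mul1r legendre_Fp // -pmulrn ua (negbTE nsq_a) rmorphN1 mulN1r.
rewrite (eq_big_seq id) => [/eqP|y yys]; last first.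
  by rewrite -(expr_mod _ (ysN y yys)) u1N ?dvdn_mull // (expr_mod _ (ysN y yys)).
by rewrite -addr_eq0 -mulr2n -mulr_natr mulf_eq0 pnatr_eq0 orbF => /eqP.
Qed.

Lemma sum_roots_conj_sqrt_prime_power (C : numClosedFieldType) (p N k t : nat)
    (ys : seq C) (d e : int) (P : C) :
  prime p -> (0 < N)%N -> coprime t N -> (forall y, y \in ys -> y ^+ N = 1) ->
  P ^+ 2 = p%:R ->
  d%:~R = P ^+ k * \sum_(y <- ys) y ->
  e%:~R = P ^+ (k * t) * \sum_(y <- ys) y ^+ t ->
  [/\ ~~ odd k -> \sum_(y <- ys) y ^+ t = \sum_(y <- ys) y,
      odd k -> odd t -> ~~ (p %| t)%N ->
        \sum_(y <- ys) y ^+ t = (sqrt_prime_sign p t)%:~R * \sum_(y <- ys) y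
    & odd k -> ~~ odd t || odd p && (p %| t)%N ->
        \sum_(y <- ys) y ^+ t = 0 /\ \sum_(y <- ys) y = 0].
Proof.
move=> p_pr N0 cotN ysN P2 dE eE.
have p_neq0 : p%:R != 0 :> C by rewrite pnatr_eq0 -lt0n prime_gt0.
have P0 : P != 0 by apply: contraNneq p_neq0 => P0; rewrite -P2 P0 expr0n.
(* An even power of P is a power of p, so S is rational. *)
have divPX j (a : int) S : ~~ odd j -> a%:~R = P ^+ j * S ->
    S = ratr (a%:~R / p%:R ^+ j./2).
  move=> jev aE; rewrite fmorph_div /= rmorphXn /= ratr_int ratr_nat aE -P2 -exprM.
  by rewrite mul2n even_halfK // mulrC mulKf // expf_neq0.
have [c sum_odd] : exists c : rat, odd k -> \sum_(y <- ys) y = ratr c * P.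
  case: k dE {eE} => [|k] dE; first by exists 0.
  (* Here k is the predecessor of the odd exponent: P times the sum is rational by [divPX], and
     dividing it by p = P^2 leaves a rational multiple of P. *)
  exists (d%:~R / p%:R ^+ k./2 / p%:R) => /= kev.
  rewrite fmorph_div /= -(divPX k _ (P * \sum_(y <- ys) y)) //; last first.
    by rewrite mulrA -exprSr.
  by rewrite ratr_nat -P2; field.
split=> [kev|kodd todd pNt|kodd tp].
- exact: rat_sum_roots_conj N0 cotN ysN (divPX _ _ _ kev dE).
- exact: sqrt_sum_roots_conj p_pr N0 todd pNt cotN ysN P2 (sum_odd kodd).
have S0 : \sum_(y <- ys) y = 0.
  have [tev|todd] := boolP (~~ odd t); last first.
    move: tp; rewrite (negbTE todd) => /andP[p_odd pt].
    apply: (sqrt_sum_roots_eq0 p_pr p_odd N0 _ ysN P2 (sum_odd kodd)).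
    by rewrite -prime_coprime //; apply: coprime_dvdl cotN.
  have ktev : ~~ odd (k * t) by rewrite oddM (negbTE tev) andbF.
  have St := divPX _ _ _ ktev eE.
  suff S1 : \sum_(y <- ys) y = \sum_(y <- ys) y ^+ t.
    have := ratr_sqrt_prime_eq0 p_pr P2 (etrans (esym (etrans S1 St)) (sum_odd kodd)).
    by rewrite (sum_odd kodd) => ->; rewrite rmorph0 mul0r.
  (* An inverse of t modulo N, by Euler. It conjugates the rational sum of the y^t back to the sum
     of the y, which is then both rational and a rational multiple of P, hence 0. *)
  pose t' := (t ^ (totient N).-1)%N.
  have cot'N : coprime t' N by apply: coprimeXl.
  rewrite -(big_map (fun y => y ^+ t) xpredT id).
  rewrite -(@rat_sum_roots_conj _ N t' _ _ N0 cot'N _ (etrans (big_map _ _ _) St)).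
    rewrite big_map; apply: eq_big_seq => y yys; rewrite -exprM -expnS.
    rewrite prednK ?totient_gt0 // -(expr_mod _ (ysN y yys)) Euler_exp_totient //.
    by rewrite (expr_mod _ (ysN y yys)).
  by move=> _ /mapP[y yys ->]; rewrite exprAC ysN ?expr1n.
by split=> //; rewrite (rat_sum_roots_conj (c := 0) N0 cotN ysN) ?rmorph0.
Qed.

(** * Point counts of the supersingular curve *)

(** q^((n-m)/2) is a power of [Num.sqrt q%:R] because n - m may be odd. For even t the integer
    divisions in the sign exponents round; this is harmless, as both defects vanish when m r is
    odd. *)
Theorem theorem1 (R : realType) (p r q : nat) (F : finFieldType) (X : curve F)
    (g s : nat) (eta : (2 * g).-tuple R[i]) (n m t : nat) :
  prime p -> (1 <= r)%N -> q = (p ^ r)%N -> #|F| = q ->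
  genus X g -> weil_numbers X eta -> supersingular q eta ->
  is_period q eta s ->
  (0 < n)%N -> m = gcdn n s -> n = (m * t)%N ->
  (odd q ->
     [/\ ~~ odd (m * r) ->
           (point_defect X n)%:~R
             = Num.sqrt q%:R ^+ (n - m) * (point_defect X m)%:~R :> R,
         odd (m * r) -> ~~ (p %| t)%N ->
           (point_defect X n)%:~R
             = Num.sqrt q%:R ^+ (n - m) * (point_defect X m)%:~R
               * (legendre ((-1) ^+ ((t - 1) %/ 2) * t%:Z) p)%:~R :> R
       & odd (m * r) -> (p %| t)%N ->
           (point_defect X n)%:~R
             = Num.sqrt q%:R ^+ (n - m) * (point_defect X m)%:~R :> R])
  /\
  (~~ odd q ->
     (~~ odd (m * r) ->
        (point_defect X n)%:~R
          = Num.sqrt q%:R ^+ (n - m) * (point_defect X m)%:~R :> R)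
     /\
     (odd (m * r) ->
        (point_defect X n)%:~R
          = Num.sqrt q%:R ^+ (n - m) * (point_defect X m)%:~R
            * (-1) ^+ ((t ^ 2 - 1) %/ 8) :> R)).
Proof.
move=> p_pr r_gt0 qE cardF _ etaX _ [s_gt0 killed _] n_gt0 mE nE.
have [m_gt0 t_gt0] : (0 < m)%N /\ (0 < t)%N by apply/andP; rewrite -muln_gt0 -nE.
have ms : (m %| s)%N by rewrite mE dvdn_gcdr.
have le_mn : (m <= n)%N by rewrite nE leq_pmulr.
pose N := (s %/ m)%N; have sE : s = (m * N)%N by rewrite mulnC divnK.
have N_gt0 : (0 < N)%N by move: s_gt0; rewrite sE muln_gt0 => /andP[].
have cotN : coprime t N.
  have : (m * gcdn t N == m * 1)%N by rewrite muln_gcdr -nE -sE -mE muln1.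
  by rewrite eqn_pmul2l.
pose Q : R[i] := sqrtC q%:R; pose P : R[i] := sqrtC p%:R.
have QE : Q = P ^+ r by rewrite /Q qE natrX rootCX ?ler0n.
have sqrtQ : (Num.sqrt (q%:R : R))%:C%C = Q.
  have qQ : q%:R = ((Num.sqrt (q%:R : R))%:C%C : R[i]) ^+ 2.
    by rewrite -rmorphXn sqr_sqrtr ?ler0n // rmorph_nat.
  by rewrite /Q qQ sqrCK // ler0c sqrtr_ge0.
have Q0 : Q != 0 by rewrite sqrtC_eq0 pnatr_eq0 qE -lt0n expn_gt0 prime_gt0.
pose ys := [seq (e / Q) ^+ m | e <- eta].
have ysN y : y \in ys -> y ^+ N = 1.
  by case/mapP=> e ee ->; rewrite -exprM -sE killed.
have defectE j : (0 < j)%N ->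
    (point_defect X (m * j))%:~R = - (Q ^+ (m * j) * \sum_(y <- ys) y ^+ j).
  move=> j_gt0; rewrite (weil_numbers_power_sum etaX) ?muln_gt0 ?m_gt0 //.
  rewrite big_map mulr_sumr; congr (- _); apply: eq_bigr => e _.
  by rewrite -exprM -exprMn mulrC divfK.
have defectmE : (point_defect X m)%:~R = - (Q ^+ m * \sum_(y <- ys) y).
  by rewrite -[X in point_defect _ X]muln1 defectE // muln1.
have defectnE : (point_defect X n)%:~R = - (Q ^+ n * \sum_(y <- ys) y ^+ t).
  by rewrite nE defectE.
(* The real identity is checked in [R[i]], where the power sums live. *)
have defect_ratio (sgn : int) :
    \sum_(y <- ys) y ^+ t = sgn%:~R * \sum_(y <- ys) y ->
    (point_defect X n)%:~R
      = Num.sqrt q%:R ^+ (n - m) * (point_defect X m)%:~R * sgn%:~R :> R.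
  move=> sgnE; apply: (@complexI R).
  rewrite !rmorphM rmorphXn !rmorph_int /= sqrtQ defectnE defectmE sgnE.
  by rewrite -{1}(subnK le_mn) exprD; ring.
have ratio1 : \sum_(y <- ys) y ^+ t = \sum_(y <- ys) y ->
    (point_defect X n)%:~R = Num.sqrt q%:R ^+ (n - m) * (point_defect X m)%:~R :> R.
  by move=> S1; rewrite (defect_ratio 1) ?mulr1 // mul1r.
have dE : (- point_defect X m)%:~R = P ^+ (m * r) * \sum_(y <- ys) y.
  by rewrite rmorphN /= defectmE opprK QE -exprM mulnC.
have eE : (- point_defect X n)%:~R = P ^+ (m * r * t) * \sum_(y <- ys) y ^+ t.
  by rewrite rmorphN /= defectnE opprK QE -exprM mulnAC -nE mulnC.
have P2 : P ^+ 2 = p%:R by rewrite sqrtCK.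
have [Sev Sodd S0] := sum_roots_conj_sqrt_prime_power p_pr N_gt0 cotN ysN P2 dE eE.
(* When both sums vanish any sign is correct, in particular the one displayed for even t and the
   factor 1 for p dividing t. *)
have ratio0 : \sum_(y <- ys) y ^+ t = 0 /\ \sum_(y <- ys) y = 0 ->
    forall sgn : int, (point_defect X n)%:~R
      = Num.sqrt q%:R ^+ (n - m) * (point_defect X m)%:~R * sgn%:~R :> R.
  by case=> St S1 sgn; apply: defect_ratio; rewrite St S1 mulr0.
have q_odd : odd q = odd p by rewrite qE oddX eqn0Ngt r_gt0.
rewrite q_odd; split=> [p_odd|p_even]; split=> mr; first by apply/ratio1/Sev.
- move=> pNt; have [todd|tev] := boolP (odd t); last by apply/ratio0/S0; rewrite ?tev.
  by apply: defect_ratio; rewrite Sodd // /sqrt_prime_sign p_odd.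
- by move=> pt; rewrite (ratio0 _ 1) ?mulr1 //; apply: S0; rewrite ?p_odd ?pt ?orbT.
- by apply/ratio1/Sev.
rewrite (_ : (-1) ^+ _ = ((-1) ^+ ((t ^ 2 - 1) %/ 8) : int)%:~R); last first.
  by rewrite rmorphXn rmorphN1.
have [todd|tev] := boolP (odd t); last by apply/ratio0/S0; rewrite ?tev.
have p2 : p = 2 by case/even_prime: p_pr => // p_odd; rewrite p_odd in p_even.
apply: defect_ratio; rewrite Sodd ?p2 ?dvdn2 ?todd //.
Qed.
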